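(* Let $x,y$ be Hermitian $n\times n$ complex matrices, and let $u(t)=e^{itx}e^{iy}=e^{ix(t)}\in U_n(\mathbb C)$ be defined for $t\in[t_1,t_2]$, where each $x(t)$ is Hermitian with $\|x(t)\|_\infty<\frac{\pi}{2}$ for all $t\in[t_1,t_2]$. Let $\|\cdot\|$ be a unitarily invariant norm. Then the function $t\mapsto\|x(t)\|$ is convex in $[t_1,t_2]$.
   Context: $U_n(\mathbb C)$ is the group of $n\times n$ unitary matrices and $\|\cdot\|_\infty$ is the spectral (operator) norm. A unitarily invariant norm is a norm $\|\cdot\|$ on $M_n(\mathbb C)$ with $\|uav\|=\|a\|$ for all $a\in M_n(\mathbb C)$ and all unitary matrices $u,v$. Under the stated bound, $x(t)=-i\log(u(t))$ for the principal branch of the logarithm. *)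

(* Defs.v *)
From HB Require Import structures.
From mathcomp Require Import all_boot all_order all_algebra.
From mathcomp Require Import complex.
From mathcomp Require Import all_classical all_reals all_analysis.

Set Implicit Arguments.
Unset Strict Implicit.
Unset Printing Implicit Defensive.

Import Order.TTheory GRing.Theory Num.Theory.
Import numFieldNormedType.Exports.

Local Open Scope classical_set_scope.
Local Open Scope ring_scope.

(* The scalars are an abstract [C] because the topology of a [numFieldType] is
   not inferred from the concrete type [R[i]]; at [C := R[i]] the limit is taken
   in the usual topology of complex matrices. *)
Definition expmx (C : numFieldType) (n : nat) (A : 'M[C]_n) : 'M[C]_n :=
  limn (series (fun k : nat => k`!%:R^-1 *: A ^+ k)).

Section ComplexMatrixNorms.
Variables (R : realType) (n : nat).

(* [normc] is the [R]-valued modulus; [`|z|] would be an element of [R[i]]. *)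
Definition l2norm (v : 'cV[R[i]]_n) : R :=
  Num.sqrt (\sum_(i < n) Normc.normc (v i 0) ^+ 2).

Definition spectral_norm (A : 'M[R[i]]_n) : R :=
  sup [set l2norm (A *m v) | v in [set v : 'cV[R[i]]_n | l2norm v <= 1]].

Definition matrix_norm (N : 'M[R[i]]_n -> R) : Prop :=
  [/\ forall A B, N (A + B) <= N A + N B,
      forall (c : R[i]) A, N (c *: A) = Normc.normc c * N A
    & forall A, N A = 0 -> A = 0].

Definition unitarily_invariant (N : 'M[R[i]]_n -> R) : Prop :=
  forall U A V : 'M[R[i]]_n, U \is unitarymx -> V \is unitarymx ->
    N (U *m A *m V) = N A.

End ComplexMatrixNorms.

(* Main.v *)
(* For midpoints, [e^{2ic} = (e^{ic} e^{ia} e^{-ic}) e^{ib}] with [a], [b], [c] the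
   logarithms at the two ends and in the middle, so midpoint convexity is the
   inequality [N z <= N a + N b] whenever [e^{iz} = e^{ia} e^{ib}], [a] and [b] having
   spectral norm below [pi/2].  To prove it, follow a logarithm [x_s] of
   [e^{ia} e^{isb}] for [0 <= s <= 1]; its spectrum stays in a compact part of
   [(-pi, pi)].  If [e^{iy} = e^{ix} e^{ihb}], the diagonal of [y - x - h b] in an
   eigenbasis of [y] is [O(h^2)], uniformly, and taking the diagonal part does not
   increase [N]; hence [N y <= N x + h N b + O(h^2)], and summing over [m] steps of
   size [1/m] gives the inequality.  Finally a bounded midpoint convex function on a
   closed interval is convex. *)
Require Import Defs.
From HB Require Import structures.
From mathcomp Require Import all_boot all_order all_algebra.
From mathcomp Require Import complex.
From mathcomp Require Import all_classical all_reals all_analysis.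
From mathcomp Require Import ring lra.

Set Implicit Arguments.
Unset Strict Implicit.
Unset Printing Implicit Defensive.

Import Order.TTheory GRing.Theory Num.Theory.
Import numFieldNormedType.Exports.

Local Open Scope classical_set_scope.
Local Open Scope ring_scope.
Local Open Scope complex_scope.

(** * Unitary diagonalization and overlaps of eigenbases *)

Section UnitaryDiagonalization.
Variables (R : realType) (n : nat).
Local Notation C := R[i].
Local Open Scope sesquilinear_scope.
Implicit Types (P Q A : 'M[C]_n) (d e : 'I_n -> C) (x y : 'I_n -> R).

Definition cis (t : R) : C := cos t +i* sin t.

(** For unitary [Q], the columns of [Q^t*] are the eigenvectors. Keeping matrices in this form turns
    exponentials into [cis] of the eigenvalues, and a logarithm into a choice of real angles. *)
Definition udiag Q d : 'M[C]_n := Q^t* *m diag_mx (\row_j d j) *m Q.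
Definition uherm Q x := udiag Q (fun j => (x j)%:C).
Definition uexp Q x := udiag Q (fun j => cis (x j)).

Lemma cisD s t : cis (s + t) = cis s * cis t.
Proof.
by apply/eqP; rewrite eq_complex /= cosD sinD eqxx addrC /=.
Qed.

Lemma cis0 : cis 0 = 1.
Proof. by rewrite /cis cos0 sin0. Qed.

Lemma conj_cis t : (cis t)^*%R = cis (- t).
Proof. by rewrite /cis cosN sinN. Qed.

Lemma unitary_tmul Q : Q \is unitarymx -> Q^t* *m Q = 1%:M.
Proof. by move=> /unitarymxP /mulmx1C. Qed.

Lemma unitary_mul_adj P Q : P \is unitarymx -> Q \is unitarymx ->
  P *m Q^t* \is unitarymx.
Proof. by move=> uP uQ; apply: (mul_unitarymx uP); rewrite trmxC_unitary. Qed.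

Lemma udiag_row Q (v : 'rV[C]_n) : Q^t* *m diag_mx v *m Q = udiag Q (v 0).
Proof. by rewrite /udiag -[v in LHS](_ : \row_j v 0 j = _) //; apply/rowP => j; rewrite mxE. Qed.

Lemma eq_udiag Q d e : d =1 e -> udiag Q d = udiag Q e.
Proof. by move=> /funext ->. Qed.

Lemma udiagM Q d e : Q \is unitarymx ->
  udiag Q d *m udiag Q e = udiag Q (fun j => d j * e j).
Proof.
move=> /unitarymxP uQ; rewrite /udiag !mulmxA -[_ *m Q *m Q^t*]mulmxA uQ mulmx1.
rewrite -[_ *m diag_mx _ *m diag_mx _]mulmxA mulmx_diag udiag_row.
by apply: eq_udiag => j; rewrite !mxE.
Qed.

Lemma udiagD Q d e : udiag Q d + udiag Q e = udiag Q (fun j => d j + e j).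
Proof.
rewrite /udiag -mulmxDl -mulmxDr -linearD /= udiag_row.
by apply: eq_udiag => j; rewrite !mxE.
Qed.

Lemma udiagZ Q (c : C) d : c *: udiag Q d = udiag Q (fun j => c * d j).
Proof.
rewrite /udiag scalemxAl scalemxAr -linearZ /= udiag_row.
by apply: eq_udiag => j; rewrite !mxE.
Qed.

Lemma udiag1 Q : Q \is unitarymx -> udiag Q (fun=> 1) = 1%:M.
Proof.
move=> uQ; rewrite /udiag -[X in diag_mx X](_ : const_mx 1 = _); last first.
  by apply/rowP=> j; rewrite !mxE.
by rewrite diag_const_mx mulmx1 unitary_tmul.
Qed.

Lemma udiagX Q d k : Q \is unitarymx ->
  udiag Q d ^+ k = udiag Q (fun j => d j ^+ k).
Proof.
move=> uQ; elim: k => [|k IHk].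
  by rewrite expr0 (eq_udiag _ (fun=> expr0 _)) udiag1.
rewrite exprS IHk [LHS](udiagM _ _ uQ).
by apply: eq_udiag => j; rewrite exprS.
Qed.

Lemma udiag_adj Q d : (udiag Q d)^t* = udiag Q (fun j => (d j)^*%R).
Proof.
rewrite /udiag !trmx_mul !map_mxM /= tr_diag_mx map_diag_mx trmxCK mulmxA udiag_row.
by apply: eq_udiag => j; rewrite !mxE.
Qed.

Lemma udiagE Q d i k : udiag Q d i k = \sum_j (Q j i)^*%R * d j * Q j k.
Proof.
rewrite mxE; apply: eq_bigr => j _; congr (_ * _).
rewrite mxE (bigD1 j) //= big1 ?addr0 => [|l lj]; first by rewrite !mxE eqxx mulr1n.
by rewrite !mxE (negbTE lj) mulr0n mulr0.
Qed.

Lemma udiag_diag Q d : Q \is unitarymx ->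
  Q *m udiag Q d *m Q^t* = diag_mx (\row_j d j).
Proof.
by move=> /unitarymxP uQ; rewrite /udiag !mulmxA uQ mul1mx -mulmxA uQ mulmx1.
Qed.

Lemma udiag_conj Q P d : P^t* *m udiag Q d *m P = udiag (Q *m P) d.
Proof. by rewrite /udiag trmx_mul map_mxM !mulmxA. Qed.

Lemma uexpD Q x y : Q \is unitarymx ->
  uexp Q x *m uexp Q y = uexp Q (fun j => x j + y j).
Proof. by move=> uQ; rewrite /uexp (udiagM _ _ uQ); apply: eq_udiag => j; rewrite cisD. Qed.

Lemma uexp_adj Q x : (uexp Q x)^t* = uexp Q (fun j => - x j).
Proof. by rewrite udiag_adj; apply: eq_udiag => j; rewrite conj_cis. Qed.

Lemma uexp0 Q : Q \is unitarymx -> uexp Q (fun=> 0) = 1%:M.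
Proof. by move=> uQ; rewrite /uexp (eq_udiag _ (fun=> cis0)) udiag1. Qed.

Lemma uexpN Q x : Q \is unitarymx -> uexp Q x *m uexp Q (fun j => - x j) = 1%:M.
Proof.
move=> uQ; rewrite uexpD // -(uexp0 uQ); apply: eq_udiag => j.
by rewrite subrr.
Qed.

Lemma uexp_unitary Q x : Q \is unitarymx -> uexp Q x \is unitarymx.
Proof. by move=> uQ; apply/unitarymxP; rewrite uexp_adj uexpN. Qed.

Lemma hermsymmx_uherm A : A \is hermsymmx ->
  exists Q, Q \is unitarymx /\ exists x, A = uherm Q x.
Proof.
move=> hA; exists (spectralmx A); split; first exact: spectral_unitarymx.
exists (fun j => complex.Re (spectral_diag A 0 j)).
have /orthomx_spectralP {1}-> := hermitian_normalmx hA.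
rewrite (invmx_unitary (spectral_unitarymx A)) udiag_row.
apply: eq_udiag => j; rewrite RRe_real //.
by have /mxOverP := hermitian_spectral_diag_real hA; apply.
Qed.

Definition sqmod (z : C) : R := complex.Re z ^+ 2 + complex.Im z ^+ 2.

Lemma sqmodE z : (sqmod z)%:C = z * z^*%R.
Proof. by rewrite /sqmod add_Re2_Im2 normCK. Qed.

Lemma sqmod_ge0 z : 0 <= sqmod z.
Proof. by rewrite addr_ge0 // sqr_ge0. Qed.

(** The squared modulus of the inner product of the [k]-th basis vector of [P] with the [j]-th of
    [Q]. *)
Definition overlap P Q k j : R := sqmod ((P *m Q^t*) k j).

(** Row [k] of the unitary matrix [P *m Q^t*] is a unit vector, so overlaps are the weights of an
    average. *)
Lemma overlap_sum P Q k : P \is unitarymx -> Q \is unitarymx ->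
  \sum_j overlap P Q k j = 1.
Proof.
move=> uP uQ; apply: complexI; rewrite rmorph_sum /=.
have /unitarymxP /matrixP /(_ k k) := unitary_mul_adj uP uQ.
rewrite !mxE eqxx mulr1n => E; rewrite -[RHS]/(1 : C) -E; apply: eq_bigr => j _.
by rewrite sqmodE !mxE.
Qed.

Lemma udiag_form P Q d k :
  (P *m udiag Q d *m P^t*) k k = \sum_j (overlap P Q k j)%:C * d j.
Proof.
have -> : P *m udiag Q d *m P^t* =
    (P *m Q^t*) *m diag_mx (\row_j d j) *m (P *m Q^t*)^t*.
  by rewrite /udiag trmx_mul map_mxM trmxCK !mulmxA.
rewrite /overlap; move: (P *m Q^t*) => M.
rewrite mul_mx_diag mxE; apply: eq_bigr => j _.
by rewrite sqmodE !mxE mulrAC.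
Qed.

(* The diagonal, in the eigenbasis of the product, of the identity
   [e^{iX} e^{iB} = W] rewritten as [e^{iB} = e^{-iX} W]. *)
Lemma udiag_overlap P Q S d x b k :
    P \is unitarymx -> Q \is unitarymx -> S \is unitarymx ->
    udiag S d = uexp Q x *m uexp P b ->
  (\sum_j (overlap S Q k j)%:C * cis (- x j)) * d k =
  \sum_j (overlap S P k j)%:C * cis (b j).
Proof.
move=> uP uQ uS E; rewrite -[RHS]udiag_form -/(uexp P b).
have -> : uexp P b = uexp Q (fun j => - x j) *m udiag S d.
  rewrite E mulmxA -[LHS]mul1mx; congr (_ *m _).
  by apply/esym/mulmx1C; exact: uexpN.
have dS : udiag S d *m S^t* = S^t* *m diag_mx (\row_j d j).
  by rewrite /udiag -[LHS]mulmxA (elimT unitarymxP uS) mulmx1.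
rewrite -[S *m _ *m _]mulmxA -[uexp Q _ *m _ *m _]mulmxA dS mulmxA [S *m _ *m _]mulmxA.
by rewrite mul_mx_diag [RHS]mxE udiag_form mxE.
Qed.

(** The phase of the [k]-th eigenvalue is absorbed into the average. The real and imaginary parts of
    this identity later compare cosines and sines of the angles. *)
Lemma uexp_overlap P Q S x y b k :
    P \is unitarymx -> Q \is unitarymx -> S \is unitarymx ->
    uexp S y = uexp Q x *m uexp P b ->
  \sum_j (overlap S Q k j)%:C * cis (y k - x j) =
  \sum_j (overlap S P k j)%:C * cis (b j).
Proof.
move=> uP uQ uS E; rewrite -(udiag_overlap k uP uQ uS E) mulr_suml.
by apply: eq_bigr => j _; rewrite -mulrA -cisD addrC.
Qed.

Lemma overlap_ge0 P Q k j : 0 <= overlap P Q k j.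
Proof. exact: sqmod_ge0. Qed.

Lemma sum_cisE (w : 'I_n -> R) x :
  \sum_j (w j)%:C * cis (x j) =
  (\sum_j w j * cos (x j)) +i* (\sum_j w j * sin (x j)).
Proof.
elim/big_rec3 : _ => [//|j a b c _ ->].
by apply/eqP; rewrite eq_complex /=; apply/andP; split; apply/eqP; ring.
Qed.

End UnitaryDiagonalization.

(** * The exponential series of ['i] times a Hermitian matrix *)

Section Exponential.
Variables (R : realType).
Local Notation C := (R[i] : numClosedFieldType).

Lemma cvg_real_complex (u : R ^nat) (l : R) :
  u @ \oo --> l -> (fun m => (u m)%:C : C) @ \oo --> (l%:C : C).
Proof.
move=> ul; apply/cvgrPdist_le => e e0.
have er : (complex.Re e)%:C = e by rewrite RRe_real // gtr0_real.
have re0 : 0 < complex.Re e by rewrite -ltcR er.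
move/cvgrPdist_le : ul => /(_ _ re0); apply: filterS => m.
rewrite -rmorphB /= normc_def /= expr0n /= addr0 sqrtr_sqr => h.
by rewrite -er lecR.
Qed.

Lemma cvg_mx (m n : nat) (T : topologicalType) (F : nat -> 'M[T]_(m, n)) (M : 'M[T]_(m, n)) :
  (forall i j, (fun k => F k i j) @ \oo --> M i j) -> F @ \oo --> M.
Proof.
move=> cF A [P MP sPA].
have : \forall k \near \oo, forall i j, P i j (F k i j).
  apply: filter_forall => i; apply: filter_forall => j.
  exact: cF (MP i j).
by apply: filterS => k Pk; apply: sPA.
Qed.

(** Separation lets [cvg_lim] identify the value of [limn] in [expmx]. *)
Lemma mx_hausdorff (m n : nat) (T : topologicalType) :
  hausdorff_space T -> hausdorff_space 'M[T]_(m, n).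
Proof.
move=> hT A B AB; apply/matrixP => i j; apply: hT => X Y AX BY.
have nb (M : 'M[T]_(m, n)) (Z : set T) : nbhs (M i j) Z ->
    nbhs M [set N : 'M[T]_(m, n) | Z (N i j)].
  (* This box constrains only the entry [(i, j)]; at every other entry the implication is
     vacuous. *)
  move=> MZ; exists (fun i' j' => [set z | i' = i -> j' = j -> Z z]) => /=.
    move=> i' j'; have [ei|ne] := pselect (i' = i); last first.
      by apply: filterE => z /ne.
    have [ej|ne] := pselect (j' = j); last first.
      by apply: filterE => z _ /ne.
    by rewrite ei ej; apply: filterS MZ => z Zz _ _.
  by move=> N NP; exact: (NP i j erefl erefl).
by have [N [XN YN]] := AB _ _ (nb _ _ AX) (nb _ _ BY); exists (N i j).
Qed.

Lemma expi_coeff (t : R) (k : nat) :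
  k`!%:R^-1 * ('i * t%:C) ^+ k = cos_coeff t k +i* sin_coeff t k :> C.
Proof.
rewrite exprMn -rmorphXn /= -(rmorph_nat (real_complex R)) -fmorphV /=.
rewrite /cos_coeff /sin_coeff /=.
(* Even powers of ['i] are real and odd ones imaginary; for odd [k], [k.-1./2] and [k./2] agree. *)
have -> : ('i : C) ^+ k = ((~~ odd k)%:R * (-1) ^+ k./2) +i* ((odd k)%:R * (-1) ^+ k.-1./2).
  rewrite -{1}(odd_double_half k) exprD -muln2 mulnC exprM sqr_i.
  have -> : (-1 : C) ^+ k./2 = ((-1) ^+ k./2)%:C by rewrite rmorphXn rmorphN1.
  have [ok|ok] := boolP (odd k).
    have -> : k.-1./2 = k./2.
      by case: k ok => //= k; rewrite uphalf_half => /negbTE ->.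
    rewrite expr1 mul0r mul1r.
    by simpc.
  by rewrite expr0 mul1r mul1r mul0r.
have -> : ((-1 : R)^k./2) = (-1) ^+ k./2 by [].
by simpc; apply/eqP; rewrite eq_complex /=; apply/andP; split; apply/eqP; ring.
Qed.

(** All partial sums are diagonal in the same basis [Q], so the limit reduces, entry by entry, to
    the cosine and sine series of the eigenvalues. *)
Lemma expmx_uherm (n : nat) (Q : 'M[R[i]]_n) (x : 'I_n -> R) : Q \is unitarymx ->
  @expmx C n ('i *: uherm Q x) = uexp Q x.
Proof.
move=> uQ; rewrite /expmx.
have -> : series (fun k : nat => (k`!%:R : C)^-1 *: ('i *: uherm Q x) ^+ k) =
    (fun m => udiag Q (fun j => series (cos_coeff (x j)) m +i* series (sin_coeff (x j)) m)).
  apply/funext => m; rewrite /series /=; elim: m => [|m IHm].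
    rewrite big_geq // -(scale0r (udiag Q (fun=> 0))) udiagZ; apply: eq_udiag => j.
    by rewrite !big_geq // mulr0.
  rewrite big_nat_recr //= IHm udiagZ udiagX // udiagZ udiagD; apply: eq_udiag => j.
  by rewrite expi_coeff !big_nat_recr //=.
apply: cvg_lim; first by apply: mx_hausdorff; exact: norm_hausdorff.
apply: cvg_mx => i k; rewrite udiagE.
under eq_fun do rewrite udiagE.
apply: cvg_big => [|j _]; first exact: add_continuous. apply: cvgM; last exact: cvg_cst.
apply: cvgM; first exact: cvg_cst.
have -> : (fun m => series (cos_coeff (x j)) m +i* series (sin_coeff (x j)) m) =
    (fun m => (series (cos_coeff (x j)) m)%:C + 'i * (series (sin_coeff (x j)) m)%:C : C).
  by apply/funext => m; simpc.
have -> : cis (x j) = (cos (x j))%:C + 'i * (sin (x j))%:C by rewrite /cis; simpc.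
apply: cvgD.
  by apply: cvg_real_complex; rewrite unlock; exact: is_cvg_series_cos_coeff.
apply: cvgM; first exact: cvg_cst.
by apply: cvg_real_complex; rewrite unlock; exact: is_cvg_series_sin_coeff.
Qed.

End Exponential.

(** * The spectral norm bounds the eigenvalues *)

Section SpectralNorm.
Variables (R : realType) (n : nat).
Local Open Scope sesquilinear_scope.
Implicit Types (Q A : 'M[R[i]]_n) (v : 'cV[R[i]]_n).

Lemma normc_sqr (z : R[i]) : Normc.normc z ^+ 2 = sqmod z.
Proof. by case: z => a b; rewrite /= sqr_sqrtr // addr_ge0 // sqr_ge0. Qed.

Lemma normc_ge0 (z : R[i]) : 0 <= Normc.normc z.
Proof. by case: z => a b; exact: sqrtr_ge0. Qed.

Lemma normc_real (t : R) : Normc.normc (t%:C) = `|t|.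
Proof. by rewrite /= expr0n /= addr0 sqrtr_sqr. Qed.

Lemma l2normZ (c : R[i]) v : l2norm (c *: v) = Normc.normc c * l2norm v.
Proof.
rewrite /l2norm -[Normc.normc c]ger0_norm ?normc_ge0 // -sqrtr_sqr -sqrtrM ?sqr_ge0 //.
rewrite mulr_sumr; congr (Num.sqrt _); apply: eq_bigr => i _.
by rewrite mxE Normc.normcM exprMn.
Qed.

Lemma normc_le_l2norm v i : Normc.normc (v i 0) <= l2norm v.
Proof.
rewrite -[leLHS]ger0_norm ?normc_ge0 // -sqrtr_sqr ler_sqrt; last first.
  by apply: sumr_ge0 => j _; exact: sqr_ge0.
rewrite (bigD1 i) //= lerDl; apply: sumr_ge0 => j _; exact: sqr_ge0.
Qed.

Lemma normc_sum (I : Type) (r : seq I) (P : pred I) (F : I -> R[i]) :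
  Normc.normc (\sum_(i <- r | P i) F i) <= \sum_(i <- r | P i) Normc.normc (F i).
Proof.
elim/big_rec2 : _ => [|i a b _ h]; first by rewrite /= expr0n /= addr0 sqrtr0.
by apply: le_trans (le_normcD _ _) _; rewrite lerD2l.
Qed.

Lemma l2norm_le_spectral_norm A v :
  l2norm v <= 1 -> l2norm (A *m v) <= spectral_norm A.
Proof.
move=> v1; apply: ub_le_sup; last by exists v.
(* The supremum is an upper bound only once the set is known to be bounded. Entries of [w] have
   modulus at most 1, so each entry of [A *m w] is bounded by a row sum of moduli. *)
exists (Num.sqrt (\sum_i (\sum_j Normc.normc (A i j)) ^+ 2)) => _ [w /= w1 <-].
apply: ler_wsqrtr; apply: ler_sum => i _; rewrite ler_pXn2r ?nnegrE ?normc_ge0 //.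
  2: by apply: sumr_ge0 => j _; exact: normc_ge0.
rewrite mxE; apply: le_trans (normc_sum _ _ _) _; apply: ler_sum => j _.
rewrite Normc.normcM ler_piMr ?normc_ge0 //.
exact: le_trans (normc_le_l2norm _ _) w1.
Qed.

(** Column [j] of [Q^t*] is a unit eigenvector for the eigenvalue [x j]. *)
Lemma uherm_le_spectral_norm Q (x : 'I_n -> R) j :
  Q \is unitarymx -> `|x j| <= spectral_norm (uherm Q x).
Proof.
move=> uQ; pose v := col j (Q^t*).
have v1 : l2norm v = 1.
  have u1 : 1%:M \is @unitarymx R[i] n n.
    by apply/unitarymxP; rewrite mul1mx trmx1 map_mx1.
  (* The squared norm of [v] is the sum of the overlaps of row [j] of [Q] with the standard
     basis. *)
  rewrite /l2norm -sqrtr1 -(overlap_sum j uQ u1); congr (Num.sqrt _).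
  apply: eq_bigr => i _; rewrite normc_sqr /overlap trmx1 map_mx1 mulmx1 !mxE.
  by apply: complexI; rewrite !sqmodE conjCK mulrC.
have <- : l2norm (uherm Q x *m v) = `|x j|.
  have -> : uherm Q x *m v = (x j)%:C *: v.
    rewrite /v !colE mulmxA /uherm /udiag -[_ *m Q *m _]mulmxA (elimT unitarymxP uQ) mulmx1.
    by rewrite -colE; apply/colP => i; rewrite mul_mx_diag -colE !mxE mulrC.
  by rewrite l2normZ v1 mulr1 normc_real.
by apply: l2norm_le_spectral_norm; rewrite v1.
Qed.

End SpectralNorm.

(** * Unitarily invariant norms and pinching *)

Section UnitarilyInvariantNorm.
Variables (R : realType) (n : nat) (N : 'M[R[i]]_n -> R).
Hypotheses (hN : matrix_norm N) (hNU : unitarily_invariant N).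
Local Open Scope sesquilinear_scope.
Implicit Types (Q A : 'M[R[i]]_n) (x y : 'I_n -> R).

Lemma norm_add A B : N (A + B) <= N A + N B.
Proof. by case: hN. Qed.

Lemma norm_scale (t : R) A : N (t%:C *: A) = `|t| * N A.
Proof. by case: hN => _ h _; rewrite h normc_real. Qed.

Lemma norm0 : N 0 = 0.
Proof. by rewrite -(scale0r 0) -[0 in LHS](rmorph0 (real_complex R)) norm_scale normr0 mul0r. Qed.

(** Follows from the axioms: [0 = N (A - A) <= 2 * N A]. *)
Lemma norm_ge0 A : 0 <= N A.
Proof.
have := norm_add A ((-1)%:C *: A); rewrite norm_scale normrN1 mul1r.
by rewrite rmorphN1 scaleN1r subrr norm0 -mulr2n pmulrn_lge0.
Qed.

Lemma norm_sum (I : Type) (r : seq I) (P : pred I) (F : I -> 'M[R[i]]_n) :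
  N (\sum_(i <- r | P i) F i) <= \sum_(i <- r | P i) N (F i).
Proof.
elim/big_rec2 : _ => [|i a b _ h]; first by rewrite norm0.
by apply: le_trans (norm_add _ _) _; rewrite lerD2l.
Qed.

Lemma norm_conj Q A : Q \is unitarymx -> N (Q *m A *m Q^t*) = N A.
Proof. by move=> uQ; apply: hNU; rewrite ?trmxC_unitary. Qed.

Lemma norm_uherm Q x : Q \is unitarymx ->
  N (uherm Q x) = N (diag_mx (\row_j (x j)%:C)).
Proof. by move=> uQ; rewrite -(udiag_diag _ uQ) norm_conj. Qed.

(* Conjugating by the reflection that flips the [a]-th coordinate and averaging
   kills the off-diagonal entries of row and column [a]. *)
Lemma norm_pinching A : N (diag_mx (\row_i A i i)) <= N A.
Proof.
pose pinch (s : seq 'I_n) : 'M[R[i]]_n :=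
  \matrix_(i, j) if (i == j) || ((i \notin s) && (j \notin s)) then A i j else 0.
have -> : diag_mx (\row_i A i i) = pinch (enum 'I_n).
  apply/matrixP => i j; rewrite !mxE !mem_enum orbF.
  by case: eqP => [->|_]; rewrite ?mulr1n ?mulr0n.
elim: (enum 'I_n) => [|a s IHs].
  by rewrite le_eqVlt [pinch _](_ : _ = A) ?eqxx //; apply/matrixP => i j; rewrite mxE orbT.
pose f (i : 'I_n) : R[i] := if i == a then -1 else 1.
pose S := diag_mx (\row_i f i).
have ff i : f i * (f i)^*%R = 1.
  by rewrite /f; case: eqP => _; rewrite ?rmorphN1 ?rmorph1 ?mulrNN mulr1.
have uS : S \is unitarymx.
  apply/unitarymxP; rewrite tr_diag_mx map_diag_mx mulmx_diag.
  rewrite -diag_const_mx; congr diag_mx; apply/rowP => i.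
  by rewrite !mxE ff.
have -> : pinch (a :: s) = (2^-1)%:C *: (pinch s + S *m pinch s *m S).
  apply/matrixP => i j; rewrite mul_diag_mx mul_mx_diag !mxE !inE !negb_or.
  have h2 (z : R[i]) : z = (2^-1)%:C * (z + z).
    rewrite -mulr2n -[z *+ 2]mulr_natl mulrA -(rmorph_nat (real_complex R)) -rmorphM.
    by rewrite mulVf ?pnatr_eq0 // mul1r.
  rewrite /f; case: (i =P j) => [<-|ij] /=.
    by case: eqP => _ /=; rewrite ?mulN1r ?mulrN1 ?mul1r ?mulr1 ?opprK -h2.
  case: (i =P a) => ia /=; case: (j =P a) => ja /=.
  - by case: ij; rewrite ia ja.
  - by rewrite mulr1 mulN1r subrr mulr0.
  - by rewrite andbF mulrN1 mul1r subrr mulr0.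
  - by rewrite mulr1 mul1r -h2.
rewrite norm_scale ger0_norm ?invr_ge0 //.
have := norm_add (pinch s) (S *m pinch s *m S); rewrite (hNU _ uS uS).
by move: IHs; lra.
Qed.

End UnitarilyInvariantNorm.

(** * Trigonometric inequalities *)

Section Scalars.
Variable R : realType.
Implicit Types (t u b : R) (f : R -> R).

Lemma ge0_MVT f (df : R -> R) u : 0 <= u ->
    (forall t, is_derive t 1 f (df t)) ->
  exists2 c, 0 <= c <= u & f u = f 0 + df c * u.
Proof.
move=> u0 fdf.
have [|c cu E] := MVT_segment u0 (fun t _ => fdf t).
  apply: derivable_within_continuous => t _; exact: ex_derive.
exists c; first by rewrite in_itv /= in cu.
by move: E; rewrite subr0 => /eqP; rewrite subr_eq addrC => /eqP.
Qed.

Lemma sin_le_id u : 0 <= u -> sin u <= u.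
Proof.
move=> u0; have [t _ ->] := ge0_MVT u0 (fun t => is_derive_sin t).
by rewrite sin0 add0r ler_piMl // cos_le1.
Qed.

(** For [u >= 0] the mean value theorem gives [1 - cos u = u * sin c] with [0 <= c <= u], and
    [sin c <= c]. *)
Lemma oneB_cos_le_sqr u : 1 - cos u <= u ^+ 2.
Proof.
rewrite -cos_norm -real_normK ?num_real //; move: `|u| (normr_ge0 u) => {}u u0.
have [c /andP[c0 cu] ->] := ge0_MVT u0 (fun t => is_derive_cos t).
rewrite cos0; have := sin_le_id c0; nra.
Qed.

Lemma cos_homo s t : 0 <= s -> s <= t -> t <= pi -> cos t <= cos s.
Proof.
move=> s0 st tp; have [->//|ne] := eqVneq s t.
rewrite ltW // ltr_cos ?in_itv /= ?lt_neqAle ?ne //; apply/andP; split => //.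
- exact: le_trans tp.
- exact: le_trans st.
Qed.

(* The error of linearising [sin] is absorbed by [1 - cos], up to the full turn
   where [1 - cos] vanishes again. *)
Lemma sin_linearization b : 0 <= b < pi ->
  exists2 K, 0 <= K & forall u, `|u| <= b *+ 2 -> `|u - sin u| <= K * (1 - cos u).
Proof.
move=> /andP[b0 bp].
(* [de] bounds [1 - cos t] from below for [pi / 2 <= t <= b *+ 2]: the cosine is at most 0 up to
   [pi] and at most [cos (b *+ 2)] beyond. In [K], the summand 1 serves [t <= pi / 2], and the
   quotient absorbs [t - sin t <= 2 pi + 1]. For [b = 0] the quotient is 0 by default and only
   [t = 0] occurs. *)
pose de := 1 - Num.max 0 (cos (b *+ 2)).
have de0 : 0 <= de by rewrite subr_ge0 ge_max ler01 cos_le1.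
pose K := 1 + (pi *+ 2 + 1) / de.
have K0 : 1 <= K by rewrite lerDl divr_ge0 // addr_ge0 // mulrn_wge0 // pi_ge0.
exists K => [|u]; first exact: le_trans ler01 K0.
suff pos t : 0 <= t -> t <= b *+ 2 -> `|t - sin t| <= K * (1 - cos t).
  case: (lerP 0 u) => u0 ub; first by apply: pos => //; rewrite -(ger0_norm u0).
  have := pos (- u); rewrite sinN cosN -opprD normrN; apply; first by rewrite oppr_ge0 ltW.
  by rewrite -(ltr0_norm u0).
move=> t0 tb; have st := sin_le_id t0; rewrite ger0_norm ?subr_ge0 //.
have c1 := cos_le1 t.
have [tp|tp] := lerP t (pi / 2).
  (* The derivative [sin + cos - 1] is nonnegative on the first quadrant. *)
  have H : 0 <= 1 - cos t - t + sin t.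
    have dG (s : R) : is_derive s (1 : R) (fun t : R => 1 - cos t - t + sin t : R)
        (sin s - 1 + cos s).
      by apply: is_derive_eq; rewrite add0r mul1r opprK.
    have [c /andP[c0 ct] ->] := ge0_MVT t0 dG.
    rewrite cos0 sin0 subrr subr0 !add0r mulr_ge0 //.
    have cc : 0 <= cos c.
      apply: cos_ge0_pihalf; rewrite (le_trans ct tp) andbT (le_trans _ c0) //.
      by rewrite oppr_le0 divr_ge0 // pi_ge0.
    have sc : 0 <= sin c.
      apply: sin_ge0_pi; rewrite c0 (le_trans (le_trans ct tp)) //.
      by rewrite ler_pdivrMr // ler_peMr ?pi_ge0 // ler1n.
    have aux (p q : R) : p ^+ 2 + q ^+ 2 = 1 -> 0 <= p <= 1 -> 0 <= q <= 1 -> 0 <= q - 1 + p by nra.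
    by apply: aux (cos2Dsin2 c) _ _; rewrite ?cc ?sc ?cos_le1 ?sin_le1.
  have : 1 - cos t <= K * (1 - cos t) by rewrite ler_peMl // subr_ge0.
  by move: H; lra.
have pi0 := pi_gt0 R.
have bpos : 0 < b by have := @pihalf_ge1 R; move: tp tb; rewrite mulr2n; lra.
have cb : cos (b *+ 2) < 1.
  rewrite cos_mulr2n cos2sin2; have := sin_gt0_pi (x:=b); rewrite bpos bp => /(_ isT) s0.
  have : 0 < sin b ^+ 2 by rewrite exprn_gt0.
  by rewrite mulr2n; lra.
have depos : 0 < de by rewrite subr_gt0 gt_max ltr01 cb.
have dec : de <= 1 - cos t.
  rewrite lerD2l lerN2 le_max; have [tpi|tpi] := lerP t pi.
    by rewrite -cos_pihalf (@cos_homo (pi / 2) t) ?(ltW tp) ?divr_ge0 ?pi_ge0.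
  (* Reflecting [t] to [2 pi - t] brings both angles into [[0, pi]], where the cosine decreases. *)
  apply/orP; right; rewrite -[cos t]cosN -[cos (b *+ 2)]cosN.
  rewrite -[cos (- t)]cosD2pi -[cos (- (b *+ 2))]cosD2pi.
  by apply: cos_homo; move: tb tpi bp; rewrite !mulr2n; lra.
have tpi2 : t <= pi *+ 2 by move: tb bp; rewrite !mulr2n; lra.
have K1 : K * de = de + (pi *+ 2 + 1) by rewrite /K mulrDl mul1r divfK // gt_eqF.
have : K * de <= K * (1 - cos t) by rewrite ler_wpM2l // (le_trans ler01 K0).
by rewrite K1; have := sin_geN1 t; lra.
Qed.

End Scalars.

(** * Logarithms of a product of two unitary matrices *)

Section Subadditivity.
Variables (R : realType) (n : nat).
Local Open Scope sesquilinear_scope.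
Implicit Types (P Q S : 'M[R[i]]_n) (a b x y : 'I_n -> R).

Lemma cos_cone (al t : R) : 0 <= al < pi / 2 -> `|t| <= al -> cos al <= cos t.
Proof.
move=> /andP[a0 ap] ta; rewrite -(cos_norm t) cos_homo //.
by have := @pi_ge0 R; move: ap; lra.
Qed.

(** On a unit eigenvector of the product, the eigenvalue is the quotient of two numbers whose
    arguments are at most [al] in modulus, namely averages of [cis (b j)] and of [cis (- a j)]. Its
    argument is therefore at most [2 al < pi], away from the cut. *)
Lemma unitary_log P Q a b (al : R) : 0 <= al < pi / 2 ->
    P \is unitarymx -> Q \is unitarymx ->
    (forall j, `|a j| <= al) -> (forall j, `|b j| <= al) ->
  exists S x, [/\ S \is unitarymx, forall j, `|x j| <= al *+ 2
    & uexp S x = uexp Q a *m uexp P b].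
Proof.
move=> alp uP uQ al_a al_b; set W := uexp Q a *m uexp P b.
have uW : W \is unitarymx := mul_unitarymx (uexp_unitary a uQ) (uexp_unitary b uP).
have nW : W \is normalmx.
  by apply/normalmxP; rewrite (elimT unitarymxP uW) unitary_tmul.
pose S := spectralmx W; have uS : S \is unitarymx := spectral_unitarymx W.
pose d j : R[i] := spectral_diag W 0 j.
have WE : udiag S d = W.
  have /orthomx_spectralP W0 := nW; rewrite [RHS]W0 (invmx_unitary uS).
  by rewrite udiag_row.
have d1 j : sqmod (d j) = 1.
  apply: complexI; rewrite sqmodE.
  have : diag_mx (\row_j (d j * (d j)^*%R)) j j = (1%:M : 'M[R[i]]_n) j j.
    rewrite -(udiag_diag _ uS) -udiagM // -udiag_adj WE (elimT unitarymxP uW).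
    by rewrite mulmx1 (elimT unitarymxP uS).
  by rewrite !mxE eqxx !mulr1n.
have cosal : 0 < cos al.
  apply: cos_gt0_pihalf; case/andP: alp => a0 ap; rewrite ap andbT (lt_le_trans _ a0) //.
  by rewrite oppr_lt0 divr_gt0 // pi_gt0.
(* An average of the [cis (c j)] stays in the unit disc, to the right of the line of abscissa
   [cos al]. *)
have cone T c (k : 'I_n) : T \is unitarymx -> (forall j, `|c j| <= al) ->
    cos al <= \sum_j overlap S T k j * cos (c j) /\
    (\sum_j overlap S T k j * cos (c j)) ^+ 2 +
      (\sum_j overlap S T k j * sin (c j)) ^+ 2 <= 1.
  move=> uT cal; split.
    rewrite -[leLHS]mul1r -(overlap_sum k uS uT) mulr_suml; apply: ler_sum => j _.
    by rewrite ler_wpM2l ?overlap_ge0 // cos_cone.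
  rewrite -[leLHS]/(sqmod (_ +i* _)) -sum_cisE -normc_sqr expr_le1 ?normc_ge0 //.
  apply: le_trans (normc_sum _ _ _) _; rewrite -(overlap_sum k uS uT).
  apply: ler_sum => j _; rewrite Normc.normcM normc_real ger0_norm ?overlap_ge0 //.
  by rewrite /cis /= cos2Dsin2 sqrtr1 mulr1.
have Red j : cos (al *+ 2) <= complex.Re (d j).
  have := udiag_overlap j uP uQ uS WE; rewrite !sum_cisE.
  have al_Na i : `|- a i| <= al by rewrite normrN.
  have [] := cone Q _ j uQ al_Na.
  have [] := cone P b j uP al_b.
  move: (d1 j); rewrite /sqmod; case: (d j) => p q /=.
  set A := \sum_j _; set B := \sum_j _; set A' := \sum_j _; set B' := \sum_j _.
  clearbody A B A' B'.
  move=> pq hA hAB hA' hAB' /eqP; rewrite eq_complex /= => /andP[/eqP EA /eqP EB].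
  rewrite cos_mulr2n; move: (cos al) cosal hA hA' => k k0 hA hA'.
  (* With [z = A + iB], [z' = A' + iB'] and [d = p + iq], one has [z = z' d], so
     [|z + z'|^2 = |z'|^2 |1 + d|^2] and [|1 + d|^2 = 2 (p + 1)]. As [|z'| <= 1] and the real part
     of [z + z'] is at least [2 cos al], [p >= 2 cos^2 al - 1]. *)
  have E : (A' ^+ 2 + B' ^+ 2) * (p + 1) * 2 = (A + A') ^+ 2 + (B + B') ^+ 2.
    have -> : (A' ^+ 2 + B' ^+ 2) * (p + 1) * 2 =
        (A' ^+ 2 + B' ^+ 2) * (2 * p + 1 + (p ^+ 2 + q ^+ 2)) by rewrite pq; ring.
    by rewrite -EA -EB; ring.
  have p1 : 0 <= p + 1 by nra.
  have kA : (2 * k) ^+ 2 <= (A + A') ^+ 2 by rewrite ler_pXn2r ?nnegrE //; lra.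
  have : (A' ^+ 2 + B' ^+ 2) * (p + 1) <= p + 1 by rewrite ler_piMl.
  have := sqr_ge0 (B + B'); rewrite mulr2n; move: kA; rewrite exprMn; lra.
(* The principal argument of [d j]: the arccosine of the real part, signed by the imaginary part. *)
pose x j := if 0 <= complex.Im (d j) then acos (complex.Re (d j)) else - acos (complex.Re (d j)).
have Re1 j : -1 <= complex.Re (d j) <= 1.
  rewrite -ler_norml -(@ler_pXn2r _ 2) ?nnegrE // expr1n real_normK ?num_real //.
  by rewrite -(d1 j) lerDl sqr_ge0.
exists S, x; split=> [|j|]; first exact: uS.
  have -> : `|x j| = acos (complex.Re (d j)).
    by rewrite /x; case: ifP => _; rewrite ?normrN ger0_norm // acos_ge0.
  rewrite leNgt; apply/negP => lt; have := Red j; rewrite leNgt => /negP; apply.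
  rewrite -[ltLHS](acosK _) ?in_itv //=; rewrite ltr_cos ?in_itv /= ?acos_ge0 ?acos_lepi //.
  by case/andP: alp => a0 ap; rewrite mulr2n; apply/andP; split; lra.
rewrite -WE; apply: eq_udiag => j; apply/eqP; rewrite eq_complex /= /x.
have E : sin (acos (complex.Re (d j))) = `|complex.Im (d j)|.
  rewrite sin_acos // -[1 in LHS](d1 j) /sqmod [_ ^+ 2 + _]addrC addrK sqrtr_sqr //.
apply/andP; case: ifP => [im|/negbT im].
  by rewrite acosK ?in_itv //= E ger0_norm.
rewrite cosN sinN acosK ?in_itv //= E ltr0_norm ?opprK //.
by rewrite ltNge.
Qed.

End Subadditivity.

(** * Norm of a logarithm of a product of exponentials *)

Section ProductOfExponentials.
Variables (R : realType) (n : nat) (N : 'M[R[i]]_n -> R).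
Hypotheses (hN : matrix_norm N) (hNU : unitarily_invariant N).
Local Open Scope sesquilinear_scope.
Implicit Types (P Q S : 'M[R[i]]_n) (a b x y : 'I_n -> R).

(** A crude bound with a constant independent of the entries; it serves the quadratic remainder and
    the boundedness of the norm of [x(t)]. *)
Lemma norm_diag_le (e : 'I_n -> R) (c : R) : (forall k, `|e k| <= c) ->
  N (diag_mx (\row_k (e k)%:C)) <= c * \sum_k N (delta_mx k k).
Proof.
move=> ec; have -> : diag_mx (\row_k (e k)%:C) = \sum_k (e k)%:C *: delta_mx k k.
  rewrite diag_mx_sum_delta; apply: eq_bigr => k _; by rewrite mxE.
apply: le_trans (norm_sum hN _ _ _) _; rewrite mulr_sumr; apply: ler_sum => k _.
by rewrite norm_scale // ler_wpM2r // norm_ge0.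
Qed.

(** In the eigenbasis of [y], the diagonal error is an average of [u - sin u] over [u = y k - x j]
    minus an average of [b j - sin b j], because the imaginary parts in [uexp_overlap] cancel the
    sines. Each average is at most [K] times that of [1 - cos]; the real parts make these equal,
    hence both at most [c]. *)
Lemma norm_log_step P Q S x y b (K c : R) : 0 <= K ->
    P \is unitarymx -> Q \is unitarymx -> S \is unitarymx ->
    uexp S y = uexp Q x *m uexp P b ->
    (forall k j, `|y k - x j - sin (y k - x j)| <= K * (1 - cos (y k - x j))) ->
    (forall j, `|b j - sin (b j)| <= K * (1 - cos (b j))) ->
    (forall j, 1 - cos (b j) <= c) ->
  N (uherm S y) <= N (uherm Q x) + N (uherm P b) +
    K * c *+ 2 * \sum_k N (delta_mx k k).
Proof.
move=> K0 uP uQ uS E Kx Kb cb.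
(* [dx] and [db] are the diagonals of [uherm Q x] and [uherm P b] in the basis [S]; pinching bounds
   their norms. *)
pose dx k := \sum_j overlap S Q k j * x j.
pose db k := \sum_j overlap S P k j * b j.
have dNx : N (diag_mx (\row_k (dx k)%:C)) <= N (uherm Q x).
  rewrite -(norm_conj hNU (uherm Q x) uS); apply: le_trans (norm_pinching hN hNU _).
  rewrite le_eqVlt (_ : \row_k _ = \row_k (S *m uherm Q x *m S^t*) k k) ?eqxx //.
  apply/rowP => k; rewrite [LHS]mxE [RHS]mxE udiag_form rmorph_sum /=.
  by apply: eq_bigr => j _; rewrite rmorphM.
have dNb : N (diag_mx (\row_k (db k)%:C)) <= N (uherm P b).
  rewrite -(norm_conj hNU (uherm P b) uS); apply: le_trans (norm_pinching hN hNU _).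
  rewrite le_eqVlt (_ : \row_k _ = \row_k (S *m uherm P b *m S^t*) k k) ?eqxx //.
  apply/rowP => k; rewrite [LHS]mxE [RHS]mxE udiag_form rmorph_sum /=.
  by apply: eq_bigr => j _; rewrite rmorphM.
pose e k := y k - dx k - db k.
have ec k : `|e k| <= K * c *+ 2.
  have := uexp_overlap k uP uQ uS E; rewrite !sum_cisE => /eqP.
  rewrite eq_complex /= => /andP[/eqP Ecos /eqP Esin].
  have -> : e k = \sum_j overlap S Q k j * (y k - x j - sin (y k - x j)) -
                  \sum_j overlap S P k j * (b j - sin (b j)).
    under eq_bigr do rewrite !mulrBr; rewrite !sumrB -mulr_suml overlap_sum // mul1r Esin.
    under [X in _ - X]eq_bigr do rewrite mulrBr.
    by rewrite sumrB /e /dx /db; ring.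
  have bound (F : 'I_n -> R) (w t : 'I_n -> R) : (forall j, 0 <= w j) ->
      (forall j, `|F j| <= K * (1 - cos (t j))) ->
    `|\sum_j w j * F j| <= K * (\sum_j w j - \sum_j w j * cos (t j)).
    move=> w0 FK; apply: le_trans (ler_norm_sum _ _ _) _.
    rewrite -sumrB mulr_sumr; apply: ler_sum => j _.
    rewrite normrM ger0_norm // -{2}[w j]mulr1 -mulrBr mulrCA.
    exact: ler_wpM2l.
  apply: le_trans (ler_normB _ _) _.
  have := bound _ _ _ (overlap_ge0 S Q k) (Kx k).
  have := bound _ _ _ (overlap_ge0 S P k) Kb.
  rewrite !overlap_sum // Ecos.
  have : K * (1 - \sum_j overlap S P k j * cos (b j)) <= K * c.
    rewrite ler_wpM2l // -(overlap_sum k uS uP) -sumrB.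
    rewrite -[leRHS]mul1r -[1](overlap_sum k uS uP) mulr_suml; apply: ler_sum => j _.
    by rewrite -{1}[overlap _ _ _ _]mulr1 -mulrBr ler_wpM2l // overlap_ge0.
  by rewrite mulr2n; lra.
rewrite norm_uherm //.
have -> : diag_mx (\row_k (y k)%:C) = diag_mx (\row_k (dx k)%:C) +
    diag_mx (\row_k (db k)%:C) + diag_mx (\row_k (e k)%:C) :> 'M[R[i]]_n.
  rewrite -!linearD /=; congr diag_mx; apply/rowP => k.
  by rewrite !mxE -!rmorphD /= /e; congr _%:C; ring.
apply: le_trans (norm_add hN _ _) _; apply: lerD; last exact: norm_diag_le.
by apply: le_trans (norm_add hN _ _) _; apply: lerD.
Qed.

Lemma norm_uherm_scale P b (h : R) : 0 <= h ->
  N (uherm P (fun j => h * b j)) = h * N (uherm P b).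
Proof.
move=> h0; rewrite -{2}(ger0_norm h0) -(norm_scale hN) udiagZ; congr N.
by apply: eq_udiag => j; rewrite rmorphM.
Qed.

Lemma norm_log_mul P Q S a b z (al : R) : 0 <= al < pi / 2 ->
    P \is unitarymx -> Q \is unitarymx -> S \is unitarymx ->
    (forall j, `|a j| <= al) -> (forall j, `|b j| <= al) ->
    (forall j, `|z j| <= al *+ 2) ->
    uexp S z = uexp Q a *m uexp P b ->
  N (uherm S z) <= N (uherm Q a) + N (uherm P b).
Proof.
move=> alp uP uQ uS al_a al_b al_z E.
have /andP[a0 ap] := alp.
have al2 : 0 <= al *+ 2 < pi by rewrite mulr2n; apply/andP; split; lra.
(* Differences of angles along the path reach [4 al < 2 pi], so the linearization at [2 al] gives
   one [K] for all steps. *)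
have [K K0 sinK] := sin_linearization al2.
pose D := K * (al ^+ 2) *+ 2 * \sum_k N (delta_mx k k).
have D0 : 0 <= D.
  by rewrite mulr_ge0 ?mulrn_wge0 ?mulr_ge0 ?sqr_ge0 ?sumr_ge0 // => k _; exact: norm_ge0.
(* Each step of size [h = 1/m] costs [h * N (uherm P b) + D * h ^+ 2]. The claim covers every
   logarithm with angles within [2 al], so it applies at the end to the given [z]. *)
have path (m : nat) : (0 < m)%N -> forall l : nat, (l <= m)%N -> forall T x,
    T \is unitarymx -> (forall j, `|x j| <= al *+ 2) ->
    uexp T x = uexp Q a *m uexp P (fun j => l%:R / m%:R * b j) ->
  N (uherm T x) <= N (uherm Q a) + l%:R / m%:R * (N (uherm P b) + D / m%:R).
Proof.
  move=> m0; have m0' : 0 < m%:R :> R by rewrite ltr0n.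
  have step (h : R) T T' x x' : 0 <= h <= 1 -> T \is unitarymx -> T' \is unitarymx ->
      (forall j, `|x j| <= al *+ 2) -> (forall j, `|x' j| <= al *+ 2) ->
      uexp T x = uexp T' x' *m uexp P (fun j => h * b j) ->
    N (uherm T x) <= N (uherm T' x') + h * N (uherm P b) + D * h ^+ 2.
    move=> /andP[h0 h1] uT uT' xal xal' ET.
    have hb j : `|h * b j| <= h * al by rewrite normrM ger0_norm // ler_wpM2l.
    have -> : D * h ^+ 2 = K * ((h * al) ^+ 2) *+ 2 * \sum_k N (delta_mx k k).
      by rewrite /D; ring.
    rewrite -(norm_uherm_scale _ _ h0).
    apply: (norm_log_step K0 uP uT' uT ET).
    - move=> k j; apply: sinK; rewrite [leRHS]mulr2n.
      by apply: le_trans (ler_normB _ _) _; apply: lerD.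
    - move=> j; apply: sinK; apply: le_trans (hb j) _.
      by rewrite !mulr2n; nra.
    - move=> j; apply: le_trans (oneB_cos_le_sqr _) _.
      by rewrite -[leLHS]real_normK ?num_real // ler_pXn2r ?nnegrE ?mulr_ge0.
  elim=> [|l IHl] lm T x uT xal ET.
    have al_a2 j : `|a j| <= al *+ 2.
      by apply: le_trans (al_a j) _; rewrite mulr2n; lra.
    (* A step of size 0 compares [x] with [a], two logarithms of the same matrix, so their
       uniqueness need not be proved separately. *)
    have Ea : uexp T x = uexp Q a *m uexp P (fun j => 0 * b j).
      by rewrite ET; congr (_ *m _); apply: eq_udiag => j; rewrite mulr0n !mul0r.
    have h0 : 0 <= (0 : R) <= 1 by rewrite lexx ler01.
    have := step 0 _ _ _ _ h0 uT uQ xal al_a2 Ea.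
    by rewrite mulr0n expr0n mulr0 !mul0r !addr0.
  have l_al j : `|l%:R / m%:R * b j| <= al.
    rewrite normrM -[leRHS]mul1r ler_pM // ger0_norm ?divr_ge0 ?ler0n //.
    by rewrite ler_pdivrMr // mul1r ler_nat ltnW.
  (* The logarithm at the previous point [l / m], possible since [l <= m] keeps the scaled angles
     within [al]. *)
  have [T' [x' [uT' xal' ET']]] := unitary_log alp uP uQ al_a l_al.
  have h01 : 0 <= (m%:R^-1 : R) <= 1.
    by rewrite invr_ge0 ler0n invf_le1 // ler1n.
  have ml : l.+1%:R / m%:R = l%:R / m%:R + m%:R^-1 :> R.
    by rewrite -natr1 mulrDl mul1r.
  have Estep : uexp T x =
      uexp T' x' *m uexp P (fun j => m%:R^-1 * b j).
    have EP : uexp P (fun j => l%:R / m%:R * b j) *m uexp P (fun j => m%:R^-1 * b j) =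
        uexp P (fun j => l.+1%:R / m%:R * b j).
      by rewrite (uexpD _ _ uP); apply: eq_udiag => j; rewrite ml mulrDl.
    rewrite ET -EP; rewrite ET'; exact: mulmxA.
  apply: le_trans (step _ _ _ _ _ h01 uT uT' xal xal' Estep) _.
  have := IHl (ltnW lm) _ _ uT' xal' ET'.
  rewrite ml; move: (l%:R / m%:R : R) => p; move: (m%:R^-1 : R) => q.
  move: (N _) (N _) (N _) => u v w; rewrite expr2; nra.
apply/ler_addgt0Pr => eps eps0.
pose m := (Num.bound (D / eps)).+1.
have m0 : 0 < m%:R :> R by rewrite ltr0n.
have Dm : D / m%:R <= eps.
  rewrite ler_pdivrMr // mulrC -ler_pdivrMr //; apply: ltW.
  apply: lt_le_trans (archi_boundP _) _; first by rewrite divr_ge0 // ltW.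
  by rewrite ler_nat.
have := path m isT m (leqnn _) S z uS al_z; rewrite divff ?gt_eqF // mul1r => h.
apply: le_trans (h _) _; last by rewrite -addrA !lerD2l.
by rewrite E; congr (_ *m _); apply: eq_udiag => j; rewrite mul1r.
Qed.

End ProductOfExponentials.

(** The excess [phi] of [f] over its chord is bounded above and at least doubles when [q] is
    replaced by [2 q] or [2 q - 1], if positive; iterating excludes a positive value. *)
Lemma midpoint_convex_bounded (R : realType) (f : R -> R) (a b M : R) :
    (forall t, a <= t <= b -> f t <= M) ->
    (forall s t, a <= s <= b -> a <= t <= b -> f ((s + t) / 2) <= (f s + f t) / 2) ->
  forall s t p, a <= s <= b -> a <= t <= b -> 0 <= p <= 1 ->
    f (p * s + (1 - p) * t) <= p * f s + (1 - p) * f t.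
Proof.
move=> fM fmid s t p sab tab p01.
pose phi q := f (q * s + (1 - q) * t) - (q * f s + (1 - q) * f t).
pose B := M + `|f s| + `|f t|.
have inab q : 0 <= q <= 1 -> a <= q * s + (1 - q) * t <= b.
  by move: sab tab => /andP[? ?] /andP[? ?] /andP[? ?]; apply/andP; split; nra.
have phiB q : 0 <= q <= 1 -> phi q <= B.
  move=> q01; have := fM _ (inab q q01); case/andP: q01 => q0 q1.
  have := ler_norm (- f s); have := ler_norm (- f t); rewrite !normrN => ht hs.
  have hs' : - (q * f s) <= `|f s|.
    by have := normr_ge0 (f s); nra.
  have ht' : - ((1 - q) * f t) <= `|f t|.
    by have := normr_ge0 (f t); nra.
  by rewrite /phi /B; lra.
have phi2 k : forall q, 0 <= q <= 1 -> phi q * 2 ^+ k <= B.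
  elim: k => [|k IHk] q q01; first by rewrite expr0 mulr1 phiB.
  have k0 : 0 <= 2 ^+ k :> R by rewrite exprn_ge0.
  case/andP: (q01) => q0 q1; rewrite exprS mulrA.
  have [q2|q2] := lerP q (1 / 2).
    have q2' : 0 <= 2 * q <= 1 by apply/andP; split; lra.
    apply: le_trans (IHk _ q2'); apply: ler_wpM2r => //.
    (* The point at [q] is the midpoint of the point at [2 q] and the end [t], where the chord is
       exact. *)
    have := fmid _ _ (inab _ q2') tab.
    have -> : (2 * q * s + (1 - 2 * q) * t + t) / 2 = q * s + (1 - q) * t by field.
    by rewrite /phi; lra.
  have q2' : 0 <= 2 * q - 1 <= 1 by apply/andP; split; lra.
  apply: le_trans (IHk _ q2'); apply: ler_wpM2r => //.
  have := fmid _ _ (inab _ q2') sab.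
  have -> : ((2 * q - 1) * s + (1 - (2 * q - 1)) * t + s) / 2 = q * s + (1 - q) * t by field.
  by rewrite /phi; lra.
rewrite -subr_le0 -/(phi p) leNgt; apply/negP => phi0.
have B0 : 0 <= B by apply: le_trans (phiB p p01); exact: ltW.
(* The exponent [k] exceeds [B / phi p], and [2 ^ k > k]. *)
have := phi2 (Num.bound (B / phi p)) p p01; apply/negP; rewrite -ltNge.
rewrite mulrC -ltr_pdivrMr //.
apply: lt_le_trans (archi_boundP _) _; first by rewrite divr_ge0 // ltW.
by rewrite -natrX ler_nat ltnW // ltn_expl.
Qed.

(** * Midpoint convexity and conclusion *)

Section Midpoint.
Variables (R : realType) (n : nat) (N : 'M[R[i]]_n -> R).
Hypotheses (hN : matrix_norm N) (hNU : unitarily_invariant N).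
Local Open Scope sesquilinear_scope.

(* Eliminating [V] gives [e^{2iC} = (e^{iC} e^{iA} e^{-iC}) e^{iB}], and the
   conjugate of [A] by [e^{iC}] has the same norm as [A]. *)
Lemma norm_log_midpoint (Q S T V : 'M[R[i]]_n) (a b c : 'I_n -> R) (al : R) :
    0 <= al < pi / 2 ->
    Q \is unitarymx -> S \is unitarymx -> T \is unitarymx ->
    (forall j, `|a j| <= al) -> (forall j, `|b j| <= al) ->
    (forall j, `|c j| <= al) ->
    uexp T a = V *m uexp Q c -> uexp Q c = V *m uexp S b ->
  N (uherm Q c) <= (N (uherm S b) + N (uherm T a)) / 2.
Proof.
move=> alp uQ uS uT al_a al_b al_c Ea Ec.
have uc := uexp_unitary c uQ.
pose T' := T *m (uexp Q c)^t*.
have uT' : T' \is unitarymx := unitary_mul_adj uT uc.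
have al_2c j : `|2 * c j| <= al *+ 2.
  by rewrite normrM ger0_norm // -[leRHS]mulr_natl ler_pM2l.
have E : uexp Q (fun j => 2 * c j) = uexp T' a *m uexp S b.
  have -> : uexp Q (fun j => 2 * c j) = uexp Q c *m uexp Q c.
    by rewrite (uexpD _ _ uQ); apply: eq_udiag => j; rewrite mulr_natl mulr2n.
  rewrite [uexp T' a](_ : _ = uexp Q c *m uexp T a *m (uexp Q c)^t*).
    (* The inner factors [e^{iC} e^{-iC}] cancel, and the remaining [V e^{iB}] is [e^{iC}]. *)
    by rewrite Ea -[_ *m (V *m _) *m _]mulmxA (mulmxtVK _ uc) -mulmxA -Ec.
  by rewrite /uexp -/(uexp Q c) /T' -udiag_conj trmxCK.
have := norm_log_mul hN hNU alp uS uT' uQ al_a al_b al_2c E.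
rewrite (norm_uherm_scale hN) // (norm_uherm hNU a uT') -(norm_uherm hNU a uT).
by lra.
Qed.

End Midpoint.

(** Provides one angle below [pi / 2] for both ends and the middle; the 0 in the maximum secures its
    sign. *)
Lemma max3_lt (R : realDomainType) (p q r c : R) : 0 < c -> p < c -> q < c -> r < c ->
  exists al, [/\ 0 <= al < c, p <= al, q <= al & r <= al].
Proof.
move=> c0 pc qc rc; exists (Num.max 0 (Num.max p (Num.max q r))).
by rewrite !gt_max c0 pc qc rc !le_max !lexx !orbT.
Qed.

Theorem theorem4p2 (R : realType) (n : nat) (x y : 'M[R[i]]_n) (t1 t2 : R)
    (u xt : R -> 'M[R[i]]_n) (N : 'M[R[i]]_n -> R)
    (hx : x \is hermsymmx) (hy : y \is hermsymmx)
    (hu : forall t : R, t1 <= t <= t2 ->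
      u t = expmx (('i * t%:C) *: x) *m expmx ('i *: y))
    (hxt : forall t : R, t1 <= t <= t2 -> xt t \is hermsymmx)
    (huxt : forall t : R, t1 <= t <= t2 -> u t = expmx ('i *: xt t))
    (hxt_lt : forall t : R, t1 <= t <= t2 -> spectral_norm (xt t) < pi / 2)
    (hN : matrix_norm N) (hNU : unitarily_invariant N) :
  convex_function (`[t1, t2]%classic : set R) (fun t => N (xt t)).
Proof.
have [X [uX [xi xE]]] := hermsymmx_uherm hx.
have [Y [uY [eta yE]]] := hermsymmx_uherm hy.
pose V t := uexp X (fun j => t * xi j); pose w := uexp Y eta.
have VD s t : V s *m V t = V (s + t).
  by rewrite [LHS](uexpD _ _ uX); apply: eq_udiag => j; rewrite mulrDl.
have uE t : t1 <= t <= t2 -> u t = V t *m w.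
  move=> tt; rewrite hu // xE yE -scalerA [_%:C *: _]udiagZ -/(uherm _ _).
  rewrite (_ : udiag X _ = uherm X (fun j => t * xi j)); last first.
    by apply: eq_udiag => j; rewrite rmorphM.
  by rewrite !expmx_uherm.
have logE t : t1 <= t <= t2 -> exists Q th, [/\ Q \is unitarymx, xt t = uherm Q th,
    u t = uexp Q th & forall j, `|th j| <= spectral_norm (xt t)].
  move=> tt; have [Q [uQ [th E]]] := hermsymmx_uherm (hxt t tt).
  exists Q, th; split=> [| | |j]; [exact: uQ|exact: E| |].
    by rewrite (huxt t tt) E expmx_uherm.
  by rewrite E uherm_le_spectral_norm.
have bounded t : t1 <= t <= t2 -> N (xt t) <= pi / 2 * \sum_k N (delta_mx k k).
  move=> tt; have [Q [th [uQ tE _ thQ]]] := logE t tt.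
  rewrite tE (norm_uherm hNU th uQ); apply: (norm_diag_le hN) => k.
  exact: le_trans (thQ k) (ltW (hxt_lt t tt)).
have midpoint s t : t1 <= s <= t2 -> t1 <= t <= t2 ->
    N (xt ((s + t) / 2)) <= (N (xt s) + N (xt t)) / 2.
  set m := (s + t) / 2 => ss tt.
  have mm : t1 <= m <= t2.
    by move: ss tt => /andP[? ?] /andP[? ?]; rewrite /m; apply/andP; split; lra.
  have [S [b [uS sE usE bS]]] := logE s ss.
  have [T [a [uT tE utE aT]]] := logE t tt.
  have [Q [c [uQ mE umE cQ]]] := logE m mm.
  have [al [alp s_al t_al m_al]] :=
    max3_lt (divr_gt0 (pi_gt0 R) (ltr0n R 2)) (hxt_lt s ss) (hxt_lt t tt) (hxt_lt m mm).
  have al_a j : `|a j| <= al := le_trans (aT j) t_al.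
  have al_b j : `|b j| <= al := le_trans (bS j) s_al.
  have al_c j : `|c j| <= al := le_trans (cQ j) m_al.
  (* The same factor [V h] carries [u s] to [u m] and [u m] to [u t], since [V] is a one-parameter
     group. *)
  pose h := (t - s) / 2.
  have hm : h + m = t by rewrite /h /m; field.
  have hs : h + s = m by rewrite /h /m; field.
  have Et : uexp T a = V h *m uexp Q c.
    by rewrite -utE -umE (uE t tt) (uE m mm) mulmxA VD hm.
  have Em : uexp Q c = V h *m uexp S b.
    by rewrite -umE -usE (uE m mm) (uE s ss) mulmxA VD hs.
  rewrite sE tE mE.
  exact: (norm_log_midpoint hN hNU alp uQ uS uT al_a al_b al_c Et Em).
move=> p s t; rewrite !inE /= !in_itv /= => ss tt.
have p01 : 0 <= (p%:num : R) <= 1 by rewrite ge0 le1.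
exact: midpoint_convex_bounded bounded midpoint _ _ _ ss tt p01.
Qed.
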